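(* For all $d\ge 2$ and $n\ge 1$, $$\mathrm{Sep}_n^{d-1} = S_n(2413,3142)^{d-1}\cap S_n^{d-1}(\mathrm{Sym}((132,213))),$$ i.e. a $d$-permutation $(\sigma_1,\dots,\sigma_{d-1})$ of size $n$ is separable if and only if each $\sigma_i$ avoids the classical patterns $2413$ and $3142$ and $(\sigma_1,\dots,\sigma_{d-1})$ avoids every $3$-dimensional pattern in $\mathrm{Sym}((132,213))$.
   Context: A $d$-permutation of size $n$ is a tuple $\boldsymbol\sigma=(\sigma_1,\dots,\sigma_{d-1})$ of permutations of $[n]$; set $\bar\sigma_1=\mathrm{Id}_n$ and $\bar\sigma_{i}=\sigma_{i-1}$ for $2\le i\le d$. Its diagram is $\{(\bar\sigma_1(i),\dots,\bar\sigma_d(i)) : i\in[n]\}$. For permutations $\sigma$ of size $n$ and $\pi$ of size $k$: $\sigma\oplus\pi=\sigma(1),\dots,\sigma(n),\pi(1)+n,\dots,\pi(k)+n$ and $\sigma\ominus\pi=\sigma(1)+k,\dots,\sigma(n)+k,\pi(1),\dots,\pi(k)$. A direction is a word $\mathbf e\in\{+,-\}^d$ with $e_1=+$. The $d$-sum of $d$-permutations $\boldsymbol\sigma,\boldsymbol\pi$ w.r.t. $\mathbf e$ is the $d$-permutation $(\bar\sigma_2\oplus_2\bar\pi_2,\dots,\bar\sigma_d\oplus_d\bar\pi_d)$ where $\oplus_i$ is $\oplus$ if $e_i=+$ and $\ominus$ if $e_i=-$. A $d$-permutation is separable if it has size $1$ or is a $d$-sum of two separable $d$-permutations; $\mathrm{Sep}_n^{d-1}$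 is the set of separable $d$-permutations of size $n$. $S_n(2413,3142)^{d-1}$ is the set of $(d-1)$-tuples of permutations each avoiding the classical patterns $2413$ and $3142$. Pattern containment: for an increasing index sequence $i_1<\dots<i_{d'}$ in $[d]$, the direct projection of $\boldsymbol\sigma$ is the $d'$-permutation with diagram $\{(p_{i_1},\dots,p_{i_{d'}}): p \in P_{\boldsymbol\sigma}\}$; $\boldsymbol\sigma$ contains a $d'$-dimensional pattern $\boldsymbol\pi$ if some direct projection of dimension $d'$ has a subset of its diagram whose standardization (same relative order in each coordinate, on a grid $[k]^{d'}$) is the diagram of $\boldsymbol\pi$. $S_n^{d-1}(\Pi)$ is the set of $d$-permutations of size $n$ avoiding all patterns of $\Pi$. $(132,213)$ is the $3$-permutation with $\sigma_1=132$, $\sigma_2=213$; for a $3\times3$ signed permutation matrix $s$, $s(\boldsymbol\pi)$ is the $3$-permutation whose diagram is the standardization of $\{sp: p\in P_{\boldsymbol\pi}\}$, and $\mathrm{Sym}((132,213))$ is the set of all $s((132,213))$ (it has 8 elements). *)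

(* Defs.v *)
From HB Require Import structures.
From mathcomp Require Import all_boot all_order all_algebra all_fingroup.
From mathcomp Require Import finmap.

Set Implicit Arguments.
Unset Strict Implicit.
Unset Printing Implicit Defensive.

Import GRing.Theory.
Local Open Scope ring_scope.
Local Open Scope fset_scope.

(* The permutation of [k], shifted to 'I_k, with one-line notation w. *)
Section WordPerm.
Variables (k : nat) (w : seq nat) (wP : perm_eq w (iota 1 k)).

Lemma word_perm_bound (i : 'I_k) : ((nth 0 w i).-1 < k)%N.
Proof.
have sw : size w = k by rewrite (perm_size wP) size_iota.
have := mem_nth 0%N (s := w) (n := i); rewrite sw ltn_ord => /(_ isT).
by rewrite (perm_mem wP) mem_iota add1n ltnS; case: (nth _ _ _).
Qed.

Lemma word_perm_inj : injective (fun i : 'I_k => Ordinal (word_perm_bound i)).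
Proof.
have sw : size w = k by rewrite (perm_size wP) size_iota.
have uw : uniq w by rewrite (perm_uniq wP) iota_uniq.
have w_gt0 (i : 'I_k) : (0 < nth 0 w i)%N.
  have := mem_nth 0%N (s := w) (n := i); rewrite sw ltn_ord => /(_ isT).
  by rewrite (perm_mem wP) mem_iota => /andP[].
move=> i j /(congr1 (fun x : 'I_k => (x : nat).+1)) /=; rewrite !prednK //.
by move/eqP; rewrite nth_uniq ?sw // => /eqP/val_inj.
Qed.

Definition word_perm : 'S_k := perm word_perm_inj.

End WordPerm.

Definition p2413 : 'S_4 := @word_perm 4 [:: 2; 4; 1; 3]%N isT.
Definition p3142 : 'S_4 := @word_perm 4 [:: 3; 1; 4; 2]%N isT.
Definition p132 : 'S_3 := @word_perm 3 [:: 1; 3; 2]%N isT.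
Definition p213 : 'S_3 := @word_perm 3 [:: 2; 1; 3]%N isT.

Definition increasing k n (f : 'I_k -> 'I_n) : Prop :=
  forall a b : 'I_k, (a < b)%N -> (f a < f b)%N.

Definition perm_contains n k (s : 'S_n) (p : 'S_k) : Prop :=
  exists2 f : 'I_k -> 'I_n, increasing f &
    forall a b : 'I_k, (s (f a) < s (f b))%N = (p a < p b)%N.

Definition perm_avoids n k (s : 'S_n) (p : 'S_k) : Prop := ~ perm_contains s p.

Section PermSums.
Variables (n k : nat) (s : 'S_n) (p : 'S_k).

Definition oplus_fun (i : 'I_(n + k)) : 'I_(n + k) :=
  match split i with
  | inl a => lshift k (s a)
  | inr b => rshift n (p b)
  end.

Definition ominus_fun (i : 'I_(n + k)) : 'I_(n + k) :=
  cast_ord (addnC k n)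
    match split i with
    | inl a => rshift k (s a)
    | inr b => lshift n (p b)
    end.

Lemma oplus_fun_inj : injective oplus_fun.
Proof.
move=> i j; rewrite /oplus_fun -{2}(splitK i) -{2}(splitK j).
case: (split i) => a; case: (split j) => b /eqP.
- by rewrite eq_lshift => /eqP/perm_inj ->.
- by rewrite eq_lrshift.
- by rewrite eq_rlshift.
- by rewrite eq_rshift => /eqP/perm_inj ->.
Qed.

Lemma ominus_fun_inj : injective ominus_fun.
Proof.
move=> i j /cast_ord_inj; rewrite -{2}(splitK i) -{2}(splitK j).
case: (split i) => a; case: (split j) => b /eqP.
- by rewrite eq_rshift => /eqP/perm_inj ->.
- by rewrite eq_rlshift.
- by rewrite eq_lrshift.
- by rewrite eq_lshift => /eqP/perm_inj ->.
Qed.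

Definition oplus : 'S_(n + k) := perm oplus_fun_inj.
Definition ominus : 'S_(n + k) := perm ominus_fun_inj.

End PermSums.

Definition dperm (d n : nat) : Type := d.-1.-tuple 'S_n.

(* The index i : 'I_d is 0-based: bar s 0 = Id and bar s i.+1 = tnth s i.
   The default value of nth is never used. *)
Definition bar d n (s : dperm d n) (i : 'I_d) : 'S_n :=
  nth 1%g (1%g :: tval s) i.

(* Permutations act on 'I_n = {0, .., n-1}; the successor moves the diagram to
   the grid [n]^d with [n] = {1, .., n}. *)
Definition dpoint d n (s : dperm d n) (j : 'I_n) : 'cV[int]_d :=
  \col_(i < d) Posz (bar s i j).+1.

Definition diagram d n (s : dperm d n) : {fset 'cV[int]_d} :=
  [fset dpoint s j | j in 'I_n].

Inductive sign : Type := Plus | Minus.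

Definition is_direction d (e : d.-tuple sign) : Prop := nth Plus e 0 = Plus.

Definition sign_sum (c : sign) n k (s : 'S_n) (p : 'S_k) : 'S_(n + k) :=
  match c with Plus => oplus s p | Minus => ominus s p end.

Definition dsum d n k (e : d.-tuple sign) (s : dperm d n) (p : dperm d k) :
    dperm d (n + k) :=
  [tuple sign_sum (nth Plus e i.+1) (tnth s i) (tnth p i) | i < d.-1].

Inductive separable_dperm (d : nat) : forall n : nat, dperm d n -> Prop :=
  | separable1 (s : dperm d 1) : separable_dperm s
  | separable_dsum (n k : nat) (e : d.-tuple sign)
      (s : dperm d n) (p : dperm d k) :
      is_direction e -> separable_dperm s -> separable_dperm p ->
      separable_dperm (dsum e s p).

(* Q has the same relative order as P in each coordinate. The definitions below
   only use it with Q a diagram of size k, which forces Q to lie on the grid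
   [k]^d and P to have no two points sharing a coordinate, so that Q is the
   standardization of P. *)
Definition standardizes_to d (P Q : {fset 'cV[int]_d}) : Prop :=
  exists f : 'cV[int]_d -> 'cV[int]_d,
    [/\ {in P &, injective f},
        Q = [fset f p | p in P] &
        {in P &, forall p q, forall i : 'I_d,
           (f p i 0 < f q i 0) = (p i 0 < q i 0)}].

Definition proj_point d d' (f : 'I_d' -> 'I_d) (p : 'cV[int]_d) : 'cV[int]_d' :=
  \col_(j < d') p (f j) 0.

Definition direct_projection d d' n (f : 'I_d' -> 'I_d)
    (s : dperm d n) (t : dperm d' n) : Prop :=
  increasing f /\ diagram t = [fset proj_point f p | p in diagram s].

Definition dperm_contains d d' n k (s : dperm d n) (p : dperm d' k) : Prop :=
  exists (f : 'I_d' -> 'I_d) (t : dperm d' n) (Q : {fset 'cV[int]_d'}),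
    [/\ direct_projection f s t, Q `<=` diagram t &
        standardizes_to Q (diagram p)].

Definition dperm_avoids d d' n k (s : dperm d n) (Pi : dperm d' k -> Prop) :
    Prop :=
  forall p : dperm d' k, Pi p -> ~ dperm_contains s p.

Definition signed_perm_mx d (s : 'M[int]_d) : Prop :=
  [/\ forall i j, s i j \in [:: -1; 0; 1],
      forall i, #|[set j | s i j != 0]| = 1%N &
      forall j, #|[set i | s i j != 0]| = 1%N].

Definition sym_class d k (p : dperm d k) (q : dperm d k) : Prop :=
  exists2 s : 'M[int]_d, signed_perm_mx s &
    standardizes_to [fset s *m x | x in diagram p] (diagram q).

Definition p132_213 : dperm 3 3 := [tuple p132; p213].

(* Main.v *)
Require Import Defs.
From mathcomp Require Import all_boot all_order all_algebra all_fingroup.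
From mathcomp Require Import finmap zify.

Set Implicit Arguments.
Unset Strict Implicit.
Unset Printing Implicit Defensive.

(** Color each pair of positions [a < b] by the vector telling, for each
    coordinate [i], whether [s_i a < s_i b]. A d-sum is exactly a cut of the
    positions all of whose crossing pairs have the same color.

    The eight elements of Sym((132,213)) are exactly the 3-permutations of size 3
    whose points have three distinct middle points in the three coordinates.
    Avoiding them therefore means that, for [a < b < c], the color of [(a, c)] is
    that of [(a, b)] or of [(b, c)]. Under this condition, if [u] is the color of
    the extreme pair and [x] the last position such that the color of [(0, x)] is
    not [u], then the cut after [x] is monochromatic unless some coordinate
    contains 2413 or 3142. Conversely, in a d-sum every occurrence of a forbidden
    pattern lies within one summand. *)

(** * Relative order and standardization of permutations *)

Lemma perm_rank n (s : 'S_n) (a : 'I_n) : s a = #|[set b | s b < s a]| :> nat.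
Proof.
rewrite -(card_imset _ (@perm_inj _ s)).
have -> : s @: [set b | s b < s a] = [set j : 'I_n | j < s a].
  apply/setP=> j; rewrite inE; apply/imsetP/idP => [[b]|lt_j].
    by rewrite inE => ? ->.
  by exists ((s^-1)%g j); rewrite ?inE permKV.
have -> : [set j : 'I_n | j < s a] =
    [set widen_ord (ltnW (ltn_ord (s a))) j | j : 'I_(s a)].
  apply/setP=> j; rewrite inE; apply/idP/imsetP => [lt_j|[k _ ->]] /=.
    by exists (Ordinal lt_j) => //; apply: val_inj.
  exact: ltn_ord.
by rewrite card_imset ?card_ord // => x y /(congr1 val) /= /val_inj.
Qed.

(** Each value is the number of values below it, so the comparisons determine the permutation. *)
Lemma perm_lt_ext n (s t : 'S_n) :
  (forall a b, (s a < s b) = (t a < t b)) -> s = t.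
Proof.
move=> st; apply/permP=> a; apply: val_inj; rewrite /= [LHS]perm_rank [RHS]perm_rank.
by congr #|pred_of_set _|; apply/setP=> b; rewrite !inE st.
Qed.

Lemma perm_gtN n (s : 'S_n) (a b : 'I_n) :
  a < b -> (s b < s a) = ~~ (s a < s b).
Proof.
move=> ab; rewrite -leqNgt ltn_neqAle; case: eqP => //= /val_inj/perm_inj E.
by rewrite E ltnn in ab.
Qed.

Section Ranking.
Variables (k : nat) (f : 'I_k -> nat) (f_inj : injective f).

Lemma rank_bound (a : 'I_k) : #|[set b | f b < f a]| < k.
Proof.
rewrite -[ltnRHS](card_ord k) -cardsT; apply: proper_card.
by rewrite properT; apply: contraTneq (in_setT a) => <-; rewrite inE ltnn.
Qed.

Lemma rank_lt (a b : 'I_k) :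
  (#|[set c | f c < f a]| < #|[set c | f c < f b]|) = (f a < f b).
Proof.
have mono x y : f x < f y -> #|[set c | f c < f x]| < #|[set c | f c < f y]|.
  move=> xy; apply: proper_card; apply/properP; split.
    by apply/subsetP=> c; rewrite !inE => /ltn_trans; apply.
  by exists x; rewrite !inE ?ltnn.
apply/idP/idP => [|/mono //]; apply: contraTT; rewrite -!leqNgt.
by rewrite [_ <= f a]leq_eqVlt => /predU1P[/f_inj ->|/mono/ltnW].
Qed.

Lemma rank_inj : injective (fun a : 'I_k => Ordinal (rank_bound a)).
Proof.
move=> a b /(congr1 val) /= eq_ab; apply: f_inj.
by have := rank_lt a b; have := rank_lt b a; rewrite eq_ab ltnn; lia.
Qed.

(** The standardization of the injective word [f]. *)
Definition rank_perm : 'S_k := perm rank_inj.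

Lemma rank_perm_lt (a b : 'I_k) : (rank_perm a < rank_perm b) = (f a < f b).
Proof. by rewrite !permE rank_lt. Qed.

End Ranking.

Lemma lshift_all k n m (f : 'I_k -> 'I_(n + m)) :
  (forall j, f j < n) -> exists g, forall j, f j = lshift m (g j).
Proof.
by move=> f_lt; exists (fun j => Ordinal (f_lt j)) => j; apply: val_inj.
Qed.

Lemma rshift_all k n m (f : 'I_k -> 'I_(n + m)) :
  (forall j, n <= f j) -> exists g, forall j, f j = rshift n (g j).
Proof.
move=> f_ge; have f_lt j : f j - n < m.
  by have := ltn_ord (f j); have := f_ge j; lia.
by exists (fun j => Ordinal (f_lt j)) => j; apply: val_inj; rewrite /= subnKC.
Qed.

Lemma ord3P (P : 'I_3 -> Prop) :
  P ord0 -> P (inord 1) -> P (inord 2) -> forall i, P i.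
Proof.
move=> P0 P1 P2 [[|[|[|//]]] lt_i].
- by rewrite (_ : Ordinal _ = ord0) //; apply: val_inj.
- by rewrite (_ : Ordinal _ = inord 1) //; apply: val_inj; rewrite /= inordK.
- by rewrite (_ : Ordinal _ = inord 2) //; apply: val_inj; rewrite /= inordK.
Qed.

Lemma ord4P (P : 'I_4 -> Prop) :
  P ord0 -> P (inord 1) -> P (inord 2) -> P (inord 3) -> forall i, P i.
Proof.
move=> P0 P1 P2 P3 [[|[|[|[|//]]]] lt_i].
- by rewrite (_ : Ordinal _ = ord0) //; apply: val_inj.
- by rewrite (_ : Ordinal _ = inord 1) //; apply: val_inj; rewrite /= inordK.
- by rewrite (_ : Ordinal _ = inord 2) //; apply: val_inj; rewrite /= inordK.
- by rewrite (_ : Ordinal _ = inord 3) //; apply: val_inj; rewrite /= inordK.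
Qed.

(** * Comparisons in direct and skew sums *)

Section SignSum.
Variables (c : sign) (n m : nat) (s : 'S_n) (p : 'S_m).

Lemma sign_sum_ltll a b :
  (sign_sum c s p (lshift m a) < sign_sum c s p (lshift m b)) = (s a < s b).
Proof.
case: c; rewrite /= !permE /oplus_fun /ominus_fun !(unsplitK (inl _)) //=.
by rewrite ltn_add2l.
Qed.

Lemma sign_sum_ltrr a b :
  (sign_sum c s p (rshift n a) < sign_sum c s p (rshift n b)) = (p a < p b).
Proof.
case: c; rewrite /= !permE /oplus_fun /ominus_fun !(unsplitK (inr _)) //=.
by rewrite ltn_add2l.
Qed.

Lemma sign_sum_ltlr a b :
  (sign_sum c s p (lshift m a) < sign_sum c s p (rshift n b)) =
  (if c is Plus then true else false).
Proof.
have := ltn_ord (s a); have := ltn_ord (p b).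
case: c; rewrite /= !permE /oplus_fun /ominus_fun.
  by rewrite (unsplitK (inl _)) (unsplitK (inr _)) /=; lia.
by rewrite (unsplitK (inl _)) (unsplitK (inr _)) /=; lia.
Qed.

Lemma sign_sum_ltrl a b :
  (sign_sum c s p (rshift n b) < sign_sum c s p (lshift m a)) =
  (if c is Plus then false else true).
Proof.
have := ltn_ord (s a); have := ltn_ord (p b).
case: c; rewrite /= !permE /oplus_fun /ominus_fun.
  by rewrite (unsplitK (inl _)) (unsplitK (inr _)) /=; lia.
by rewrite (unsplitK (inl _)) (unsplitK (inr _)) /=; lia.
Qed.

(** Stated for positions of the sum rather than shifted ones, so that case analyses on the side of
    each position can feed it to [lia]. *)
Lemma sign_sum_cross :
  (forall x y : 'I_(n + m), x < n -> n <= y -> sign_sum c s p x < sign_sum c s p y)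
  \/
  (forall x y : 'I_(n + m), x < n -> n <= y -> sign_sum c s p y < sign_sum c s p x).
Proof.
have l (x : 'I_(n + m)) : x < n -> exists a, x = lshift m a.
  by move=> lt_x; exists (Ordinal lt_x); apply: val_inj.
have r (x : 'I_(n + m)) : n <= x -> exists a, x = rshift n a.
  by case: (split_ordP x) => j -> //=; [have := ltn_ord j; lia | exists j].
case E: c; [left | right] => x y /l[a ->] /r[b ->]; rewrite -E.
  by rewrite sign_sum_ltlr E.
by rewrite sign_sum_ltrl E.
Qed.

End SignSum.

(** * Middle points in d-sums *)

Section Dimension.
Variable d : nat.

Lemma bar0 n (s : dperm d.+1 n) : bar s ord0 = 1%g. Proof. by []. Qed.

Lemma bar_lift n (s : dperm d.+1 n) (i : 'I_d) : bar s (lift ord0 i) = tnth s i.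
Proof. by rewrite /bar (tnth_nth 1%g). Qed.

(** Coordinate 0 obeys the same formula as the others: a direction has sign [Plus] there, and the
    direct sum of two identities is the identity. *)
Lemma bar_dsum n m (e : d.+1.-tuple sign) (s : dperm d.+1 n) (p : dperm d.+1 m) i :
  is_direction e -> bar (dsum e s p) i = sign_sum (nth Plus e i) (bar s i) (bar p i).
Proof.
move=> e0; case: (unliftP ord0 i) => [j ->|->]; last first.
  rewrite e0 !bar0; apply/permP=> a; apply: val_inj.
  by rewrite perm1 permE /oplus_fun; case: (split_ordP a) => b ->; rewrite perm1.
by rewrite !bar_lift tnth_mktuple.
Qed.

Definition between n (s : 'S_n) x y z := (s x < s y < s z) || (s z < s y < s x).

(** A form of avoiding Sym((132,213)) that is visibly invariant under signed permutations of the
    axes. Betweenness is strict, so it forces the three points, and hence the three coordinates, to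
    be distinct. *)
Definition no_three_middles n (s : dperm d.+1 n) :=
  forall (f : 'I_3 -> 'I_n) (i j k : 'I_d.+1),
  let x := f ord0 in let y := f (inord 1) in let z := f (inord 2) in
  ~ [/\ between (bar s i) y x z, between (bar s j) x y z
      & between (bar s k) x z y].

(* A point alone on its side of the cut is extremal in every coordinate. *)
Lemma dsum_no_three_middles n m (e : d.+1.-tuple sign) (s : dperm d.+1 n)
    (p : dperm d.+1 m) :
  is_direction e -> no_three_middles s -> no_three_middles p ->
  no_three_middles (dsum e s p).
Proof.
move=> e0 Hs Hp f i j k /=; set x := f ord0; set y := f (inord 1); set z := f (inord 2) => mid.
have side : [/\ x < n, y < n & z < n] \/ [/\ n <= x, n <= y & n <= z].
  case: mid; rewrite !bar_dsum // /between => mi mj mk.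
  have ci := sign_sum_cross (nth Plus e i) (bar s i) (bar p i).
  have cj := sign_sum_cross (nth Plus e j) (bar s j) (bar p j).
  have ck := sign_sum_cross (nth Plus e k) (bar s k) (bar p k).
  case: (ltnP x n) => hx; case: (ltnP y n) => hy; case: (ltnP z n) => hz;
    [by left | exfalso .. | by right].
  - by case: ck mk => H; have := H x z hx hz; have := H y z hy hz; lia.
  - by case: cj mj => H; have := H x y hx hy; have := H z y hz hy; lia.
  - by case: ci mi => H; have := H x y hx hy; have := H x z hx hz; lia.
  - by case: ci mi => H; have := H y x hy hx; have := H z x hz hx; lia.
  - by case: cj mj => H; have := H y x hy hx; have := H y z hy hz; lia.
  - by case: ck mk => H; have := H z x hz hx; have := H z y hz hy; lia.
move: mid; rewrite /x /y /z; case: side => -[hx hy hz].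
  have [g fg] := lshift_all (ord3P (P := fun j => f j < n) hx hy hz).
  rewrite !fg !bar_dsum // /between !sign_sum_ltll; exact: Hs.
have [g fg] := rshift_all (ord3P (P := fun j => n <= f j) hx hy hz).
rewrite !fg !bar_dsum // /between !sign_sum_ltrr; exact: Hp.
Qed.

End Dimension.

(** * The concrete patterns, and avoidance by separable permutations *)

Lemma p132E (a : 'I_3) : p132 a = nth 0 [:: 0; 2; 1] a :> nat.
Proof. by rewrite permE /=; case: a => [[|[|[|//]]]]. Qed.
Lemma p213E (a : 'I_3) : p213 a = nth 0 [:: 1; 0; 2] a :> nat.
Proof. by rewrite permE /=; case: a => [[|[|[|//]]]]. Qed.
Lemma p2413E (a : 'I_4) : p2413 a = nth 0 [:: 1; 3; 0; 2] a :> nat.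
Proof. by rewrite permE /=; case: a => [[|[|[|[|//]]]]]. Qed.
Lemma p3142E (a : 'I_4) : p3142 a = nth 0 [:: 2; 0; 3; 1] a :> nat.
Proof. by rewrite permE /=; case: a => [[|[|[|[|//]]]]]. Qed.

Lemma contains_2413 n (s : 'S_n) (a b c e : 'I_n) :
  a < b < c -> c < e -> s c < s a < s e -> s e < s b -> perm_contains s p2413.
Proof.
move=> abc ce h1 h2; exists (tnth [tuple a; b; c; e]).
  by move=> [[|[|[|[|//]]]] ?] [[|[|[|[|//]]]] ?]; rewrite !(tnth_nth a) /=; lia.
move=> [[|[|[|[|//]]]] ?] [[|[|[|[|//]]]] ?];
  by rewrite !(tnth_nth a) !p2413E /=; lia.
Qed.

Lemma contains_3142 n (s : 'S_n) (a b c e : 'I_n) :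
  a < b < c -> c < e -> s b < s e < s a -> s a < s c -> perm_contains s p3142.
Proof.
move=> abc ce h1 h2; exists (tnth [tuple a; b; c; e]).
  by move=> [[|[|[|[|//]]]] ?] [[|[|[|[|//]]]] ?]; rewrite !(tnth_nth a) /=; lia.
move=> [[|[|[|[|//]]]] ?] [[|[|[|[|//]]]] ?];
  by rewrite !(tnth_nth a) !p3142E /=; lia.
Qed.

(* Neither pattern is a sum, so any occurrence lies within one summand. *)
Lemma sign_sum_avoids (q : 'S_4) c n m (s : 'S_n) (p : 'S_m) :
  q = p2413 \/ q = p3142 ->
  perm_avoids s q -> perm_avoids p q -> perm_avoids (sign_sum c s p) q.
Proof.
move=> Eq As Ap [f f_inc f_ord].
have i01 : f ord0 < f (inord 1) by apply: f_inc; rewrite inordK.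
have i12 : f (inord 1) < f (inord 2) by apply: f_inc; rewrite !inordK.
have i23 : f (inord 2) < f (inord 3) by apply: f_inc; rewrite !inordK.
have side : f (inord 3) < n \/ n <= f ord0.
  have cross := sign_sum_cross c s p.
  have o01 := f_ord ord0 (inord 1); have o02 := f_ord ord0 (inord 2).
  have o03 := f_ord ord0 (inord 3); have o12 := f_ord (inord 1) (inord 2).
  have o13 := f_ord (inord 1) (inord 3); have o23 := f_ord (inord 2) (inord 3).
  case: (ltnP (f (inord 3)) n) => h3; first by left.
  case: (ltnP (f ord0) n) => h0; last by right.
  exfalso; move: o01 o02 o03 o12 o13 o23.
  case: cross Eq => H [] ->; have c03 := H _ _ h0 h3;
    rewrite ?p2413E ?p3142E !inordK //=;
    case: (ltnP (f (inord 1)) n) => h1; case: (ltnP (f (inord 2)) n) => h2;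
    try (have := H _ _ h0 h1); try (have := H _ _ h0 h2);
    try (have := H _ _ h1 h3); try (have := H _ _ h2 h3);
    try (have := H _ _ h1 h2); lia.
case: side => h.
  have [|g fg] := @lshift_all 4 n m f; first by apply: ord4P; lia.
  apply: As; exists g => [a b /f_inc|a b]; first by rewrite !fg.
  by rewrite -f_ord !fg sign_sum_ltll.
have [|g fg] := @rshift_all 4 n m f; first by apply: ord4P; lia.
apply: Ap; exists g => [a b /f_inc|a b]; first by rewrite !fg /= ltn_add2l.
by rewrite -f_ord !fg sign_sum_ltrr.
Qed.

Lemma separable_avoids d n (s : dperm d.+1 n) : separable_dperm s ->
  no_three_middles s /\
  forall i, perm_avoids (tnth s i) p2413 /\ perm_avoids (tnth s i) p3142.
Proof.
elim=> {n s} [s|n m e s p e0 _ [Ms As] _ [Mp Ap]]; split.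
- move=> f i j k /= [+ _ _]; rewrite /between.
  by rewrite (ord1 (f ord0)) (ord1 (f (inord 1))) ltnn andbF.
- have no_inc (f : 'I_4 -> 'I_1) : ~ increasing f.
    by move/(_ ord0 ord_max isT); rewrite !ord1.
  by move=> i; split=> -[f /no_inc].
- exact: dsum_no_three_middles.
- move=> i; have [As1 As2] := As i; have [Ap1 Ap2] := Ap i.
  by rewrite tnth_mktuple; split; apply: sign_sum_avoids; auto.
Qed.

(** * From colors to separability *)

Section Coloring.
Variable d : nat.

(** Coordinate 0 is left out: being the identity, it increases on every pair [a < b]. *)
Definition color n (s : dperm d.+1 n) (a b : 'I_n) : {ffun 'I_d -> bool} :=
  [ffun i => tnth s i a < tnth s i b].

(** The invariant of the induction: it yields a cut and passes to both summands. *)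
Definition color_good n (s : dperm d.+1 n) :=
  (forall a b c : 'I_n, a < b < c ->
     color s a c = color s a b \/ color s a c = color s b c) /\
  forall i, perm_avoids (tnth s i) p2413 /\ perm_avoids (tnth s i) p3142.

Lemma color_good_sub n m (g : 'I_m -> 'I_n) (s : dperm d.+1 n) (t : dperm d.+1 m) :
  increasing g ->
  (forall i a b, (tnth t i a < tnth t i b) = (tnth s i (g a) < tnth s i (g b))) ->
  color_good s -> color_good t.
Proof.
move=> g_inc ts [Ts As].
have col a b : color t a b = color s (g a) (g b).
  by apply/ffunP=> i; rewrite !ffunE ts.
have sub i (q : 'S_4) : perm_contains (tnth t i) q -> perm_contains (tnth s i) q.
  move=> [f f_inc f_ord]; exists (g \o f) => [a b /f_inc/g_inc //|a b].
  by rewrite -f_ord ts.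
split=> [a b c /andP[ab bc]|i]; first by rewrite !col; apply: Ts; rewrite !g_inc.
by have [A1 A2] := As i; split=> /sub.
Qed.

(** The six comparisons are those of 2413 when [t] is true, and those of its complement 3142 when
    [t] is false. *)
Lemma contains_2413_or_3142 n (s : 'S_n) (a b c e : 'I_n) (t : bool) :
  a < b < c -> c < e ->
  [/\ (s a < s b) = t, (s a < s e) = t & (s c < s e) = t] ->
  [/\ (s a < s c) = ~~ t, (s b < s c) = ~~ t & (s b < s e) = ~~ t] ->
  perm_contains s p2413 \/ perm_contains s p3142.
Proof.
move=> abc ce [ab ae ce'] [ac bc be].
have eab : (s b < s a) = ~~ (s a < s b) by apply: perm_gtN; lia.
have eac : (s c < s a) = ~~ (s a < s c) by apply: perm_gtN; lia.
have ebe : (s e < s b) = ~~ (s b < s e) by apply: perm_gtN; lia.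
have ece : (s e < s c) = ~~ (s c < s e) by apply: perm_gtN; lia.
have eae : (s e < s a) = ~~ (s a < s e) by apply: perm_gtN; lia.
case: t ab ae ce' ac bc be => ab ae ce' ac bc be.
  by left; apply: contains_2413 abc ce _ _; lia.
by right; apply: contains_3142 abc ce _ _; lia.
Qed.

(* The color [u] of the extreme pair is the only possible color of a cut. Cutting
   after the last [x] with [color s 0 x != u] works: a pair [y < z] across the
   cut with another color would make [0 < y < x < z] a 2413 or a 3142 in any
   coordinate that distinguishes the two colors. *)
Lemma exists_cut n (s : dperm d.+1 n.+2) : color_good s ->
  exists k u, 0 < k < n.+2 /\ forall a b : 'I_n.+2, a < k <= b -> color s a b = u.
Proof.
case=> Ts As; pose u := color s ord0 ord_max.
(* Admitting position 0 guarantees that a maximum exists; it also covers the cut after the first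
   position. *)
pose P (x : 'I_n.+2) := (x == ord0) || (color s ord0 x != u).
case: (@arg_maxnP _ ord0 P (fun x => nat_of_ord x)) => // x Px x_max.
have lt_x : x < n.+1.
  rewrite ltn_neqAle -ltnS ltn_ord andbT; apply: contraTneq Px => Ex.
  by rewrite (_ : x = ord_max) ?/P ?eqxx //; apply: val_inj.
exists x.+1, u; split=> // y z /andP[le_yx lt_xz].
have cz : color s ord0 z = u.
  apply/eqP; apply: contraTT lt_xz => cz; rewrite -leqNgt.
  by apply: x_max; rewrite /P cz orbT.
apply/eqP; case: (posnP y) => [y0|y0].
  by rewrite (_ : y = ord0) ?cz //; apply: val_inj.
case: (eqVneq (color s y z) u) => // cyz.
have {Px} cx : color s ord0 x != u.
  by case/orP: Px => // /eqP x0; move: le_yx; rewrite x0 /=; lia.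
(* In each of the next four triangles the long side is known to differ in color from one short side,
   so it shares the color of the other. *)
have cy : color s ord0 y = u.
  have [||] := Ts ord0 y z; rewrite ?cz //=; first by lia.
  by move=> E; rewrite E eqxx in cyz.
have lt_yx : y < x.
  rewrite ltn_neqAle -ltnS le_yx andbT; apply: contraNneq cx => /val_inj <-.
  by rewrite cy.
have cyx : color s ord0 x = color s y x.
  by have [||] := Ts ord0 y x; rewrite ?cy //=; [lia | move/eqP: cx].
have cxz : color s x z = u.
  by have [||] := Ts ord0 x z; rewrite ?cz //=; [lia | move=> E; rewrite -E eqxx in cx].
have cyz' : color s y z = color s ord0 x.
  have [||] := Ts y x z; rewrite ?cxz -?cyx //=; first by lia.
  by move/eqP: cyz.
have [i ui] : exists i, color s ord0 x i != u i.
  apply/existsP; apply: contraNT cx => /existsPn E; apply/eqP/ffunP=> i.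
  by apply/eqP; have := E i; rewrite negbK.
have at_i v w c : color s v w = c -> (tnth s i v < tnth s i w) = c i.
  by move=> <-; rewrite ffunE.
have {}ui : color s ord0 x i = ~~ u i by case: (u i) (color s ord0 x i) ui => [] [].
have [A1 A2] := As i.
have [||||/A1 //|/A2 //] := @contains_2413_or_3142 _ (tnth s i) ord0 y x z (u i).
- by rewrite y0.
- by [].
- by rewrite (at_i _ _ _ cz) (at_i _ _ _ cy) (at_i _ _ _ cxz).
- by rewrite (at_i _ _ _ cyz') (at_i _ _ _ (esym cyx)) (at_i _ _ _ erefl) ui.
Qed.

(** The color [u] gives the signs and each summand is the standardization of its block. The sum then
    compares every pair as [s] does, which suffices by [perm_lt_ext]. *)
Lemma cut_dsum k m (s : dperm d.+1 (k + m)) u :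
  (forall a b : 'I_(k + m), a < k <= b -> color s a b = u) ->
  exists (e : d.+1.-tuple sign) (s1 : dperm d.+1 k) (s2 : dperm d.+1 m),
  [/\ is_direction e, s = dsum e s1 s2,
      forall i a b, (tnth s1 i a < tnth s1 i b) =
        (tnth s i (lshift m a) < tnth s i (lshift m b)) &
      forall i a b, (tnth s2 i a < tnth s2 i b) =
        (tnth s i (rshift k a) < tnth s i (rshift k b))].
Proof.
move=> cut.
have inj1 i : injective (fun a => val (tnth s i (lshift m a))).
  by move=> a b /val_inj/perm_inj/lshift_inj.
have inj2 i : injective (fun a => val (tnth s i (rshift k a))).
  by move=> a b /val_inj/perm_inj/rshift_inj.
pose e := [tuple of Plus :: [tuple if u i then Plus else Minus | i < d]].
pose s1 : dperm d.+1 k := [tuple rank_perm (inj1 i) | i < d].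
pose s2 : dperm d.+1 m := [tuple rank_perm (inj2 i) | i < d].
have lt1 i a b : (tnth s1 i a < tnth s1 i b) =
    (tnth s i (lshift m a) < tnth s i (lshift m b)).
  by rewrite tnth_mktuple rank_perm_lt.
have lt2 i a b : (tnth s2 i a < tnth s2 i b) =
    (tnth s i (rshift k a) < tnth s i (rshift k b)).
  by rewrite tnth_mktuple rank_perm_lt.
exists e, s1, s2; split=> //; apply: eq_from_tnth => i.
rewrite tnth_mktuple; apply: perm_lt_ext => a b.
have -> : nth Plus e i.+1 = if u i then Plus else Minus.
  rewrite -[RHS](tnth_mktuple (fun j => if u j then Plus else Minus)).
  by rewrite (tnth_nth Plus).
have cross (x : 'I_k) (y : 'I_m) : (tnth s i (lshift m x) < tnth s i (rshift k y)) = u i.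
  by rewrite -(cut (lshift m x) (rshift k y)) ?ffunE //= ltn_ord leq_addr.
case: (split_ordP a) => x ->; case: (split_ordP b) => y ->.
- by rewrite sign_sum_ltll lt1.
- by rewrite sign_sum_ltlr cross; case: (u i).
- rewrite sign_sum_ltrl perm_gtN ?cross; first by case: (u i).
  by rewrite /= ltn_addr.
- by rewrite sign_sum_ltrr lt2.
Qed.

Lemma color_good_separable n (s : dperm d.+1 n) :
  0 < n -> color_good s -> separable_dperm s.
Proof.
have [N le_nN] := ubnP n.
elim: N n s le_nN => // N IH [|[|n]] // s le_nN _ good; first exact: separable1.
have [k [u [k_bd cut]]] := exists_cut good.
have En : n.+2 = k + (n.+2 - k) by lia.
have m_gt0 : 0 < n.+2 - k by lia.
(* The type of [s] mentions its size, so [s] and its hypotheses are generalized before the size is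
   rewritten as [k + m]. *)
move: (n.+2 - k) En m_gt0 => m En m_gt0.
move: s good cut k_bd le_nN; rewrite {n}En => s good cut k_bd le_nN.
have [e [s1 [s2 [e0 Es lt1 lt2]]]] := cut_dsum cut.
rewrite Es; apply: separable_dsum => //; apply: IH; try lia.
- by apply: (@color_good_sub _ _ (lshift m) s) _ lt1 good => a b.
- by apply: (@color_good_sub _ _ (@rshift k m) s) _ lt2 good => a b /=; rewrite ltn_add2l.
Qed.

End Coloring.

(** * Diagrams and pattern containment in terms of order embeddings *)

Section Diagrams.
Import GRing.Theory Num.Theory Order.TTheory.

Lemma diagramP d n (s : dperm d n) x :
  reflect (exists a, x = dpoint s a) (x \in diagram s).
Proof.
by apply: (iffP (imfsetP _ _ _ _)) => [[a _ ->]|[a ->]]; exists a.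
Qed.

Lemma dpoint_lt d n (s : dperm d n) (i : 'I_d) (a b : 'I_n) :
  (dpoint s a i ord0 < dpoint s b i ord0)%R = (bar s i a < bar s i b).
Proof. by rewrite !mxE ltz_nat ltnS. Qed.

(** Choosing a preimage of each point of the diagram replaces sets of points by families indexed by
    positions. *)
Lemma standardizes_to_diagram d k (q : dperm d k) P :
  standardizes_to P (diagram q) ->
  exists g : 'I_k -> 'cV[int]_d, (forall a, g a \in P) /\
  forall i a b, (g a i ord0 < g b i ord0)%R = (bar q i a < bar q i b).
Proof.
case=> f [_ Eq f_ord].
have ex a : exists x, (x \in P) && (dpoint q a == f x).
  have : dpoint q a \in diagram q by apply/diagramP; exists a.
  by rewrite Eq => /imfsetP[x Px E]; exists x; rewrite Px E eqxx.
have [g /all_and2[gP gq]] : exists g, forall a, g a \in P /\ dpoint q a = f (g a).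
  by exists (fun a => xchoose (ex a)) => a; case/andP: (xchooseP (ex a)) => ? /eqP.
by exists g; split=> // i a b; rewrite -dpoint_lt !gq f_ord.
Qed.

Lemma diagram_standardization d k (q : dperm d.+1 k) (g : 'I_k -> 'cV[int]_d.+1) :
  (forall i a b, (g a i ord0 < g b i ord0)%R = (bar q i a < bar q i b)) ->
  standardizes_to [fset g a | a in 'I_k]%fset (diagram q).
Proof.
move=> g_ord.
(* Coordinate 0 of [q] is the identity, so it already separates the points. *)
have g_inj : injective g.
  move=> a b gab; apply: val_inj.
  have := g_ord ord0 a b; have := g_ord ord0 b a; rewrite gab ltxx !bar0 !perm1.
  by rewrite /=; lia.
(* The value 0 is only taken outside the image of [g], where [f] is never evaluated. *)
pose f x := if [pick a | g a == x] is Some a then dpoint q a else 0%R.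
have fg a : f (g a) = dpoint q a.
  rewrite /f; case: pickP => [b /eqP/g_inj -> //|/(_ a)].
  by rewrite eqxx.
exists f; split.
- move=> x y /imfsetP[a _ ->] /imfsetP[b _ ->]; rewrite !fg => /colP/(_ ord0).
  by rewrite !mxE !bar0 !perm1 => -[/val_inj ->].
- apply/fsetP=> x; apply/diagramP/imfsetP => /= [[a ->]|[_ /imfsetP[a _ ->] ->]].
    by exists (g a); rewrite ?fg //; apply/imfsetP; exists a.
  by exists a.
- move=> x y /imfsetP[a _ ->] /imfsetP[b _ ->] i.
  by rewrite !fg dpoint_lt g_ord.
Qed.

Lemma dperm_contains_embedding d d' n k (s : dperm d n) (p : dperm d' k) :
  dperm_contains s p ->
  exists (f : 'I_d' -> 'I_d) (h : 'I_k -> 'I_n), forall i a b,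
  (bar s (f i) (h a) < bar s (f i) (h b)) = (bar p i a < bar p i b).
Proof.
case=> f [t [Q [[_ Et] /fsubsetP QP /standardizes_to_diagram[g [gQ g_ord]]]]].
have ex a : exists c, g a == proj_point f (dpoint s c).
  have := QP _ (gQ a); rewrite Et => /imfsetP[_ /diagramP[c ->] ->].
  by exists c.
have [h gh] : exists h : 'I_k -> 'I_n, forall a, g a = proj_point f (dpoint s (h a)).
  by exists (fun a => xchoose (ex a)) => a; apply/eqP/(xchooseP (ex a)).
exists f, h => i a b; rewrite -g_ord !gh -dpoint_lt !mxE.
by [].
Qed.

Lemma embedding_dperm_contains d d' n k (s : dperm d n) (p : dperm d'.+1 k)
    (f : 'I_d'.+1 -> 'I_d) (h : 'I_k -> 'I_n) :
  increasing f ->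
  (forall i a b,
     (bar s (f i) (h a) < bar s (f i) (h b)) = (bar p i a < bar p i b)) ->
  dperm_contains s p.
Proof.
(* The projection may drop coordinate 0 of [s]; reindexing the positions by [r] makes its first
   coordinate the identity again. *)
move=> f_inc h_ord; pose r := bar s (f ord0).
pose t : dperm d'.+1 n :=
  [tuple (r^-1 * bar s (f (lift ord0 i)))%g | i < d'].
have bar_t i : bar t i = (r^-1 * bar s (f i))%g.
  by case: (unliftP ord0 i) => [j|] ->; rewrite ?bar_lift ?tnth_mktuple // mulVg.
have pt c : proj_point f (dpoint s c) = dpoint t (r c).
  by apply/colP=> i; rewrite !mxE bar_t permM permK.
exists f, t, [fset proj_point f (dpoint s (h a)) | a in 'I_k]%fset; split.
- split=> //; apply/fsetP=> x; apply/diagramP/imfsetP => /= [[a ->]|].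
    exists (dpoint s ((r^-1)%g a)); last by rewrite pt permKV.
    by apply/diagramP; exists ((r^-1)%g a).
  by case=> _ /diagramP[c ->] ->; exists (r c).
- apply/fsubsetP=> _ /imfsetP[a _ ->]; rewrite pt.
  by apply/diagramP; exists (r (h a)).
- apply: diagram_standardization => i a b.
  by rewrite !pt dpoint_lt !bar_t !permM !permK h_ord.
Qed.

Definition flip_lt (e : bool) (x y : nat) := if e then y < x else x < y.

(** The only nonzero entry of row [i] lies in column [pi i]; uniqueness within columns makes [pi]
    injective. *)
Lemma signed_perm_mxP d (A : 'M[int]_d) : signed_perm_mx A ->
  exists (pi : 'I_d -> 'I_d) (e : 'I_d -> bool), injective pi /\
  forall i (x : 'cV[int]_d),
  (A *m x)%R i ord0 = ((-1) ^+ e i * x (pi i) ord0)%R.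
Proof.
case=> A_val A_row A_col.
have ex i : exists j, A i j != 0%R.
  have /eqP/cards1P[j Ej] := A_row i; exists j.
  by have := set11 j; rewrite -Ej inE.
pose pi i := xchoose (ex i); have piP i : A i (pi i) != 0%R := xchooseP (ex i).
have pi_uniq i j : A i j != 0%R -> j = pi i.
  have /eqP/cards1P[l El] := A_row i => Aij.
  have : j \in [set j | A i j != 0%R] by rewrite inE.
  have : pi i \in [set j | A i j != 0%R] by rewrite inE.
  by rewrite El !inE => /eqP -> /eqP ->.
exists pi, (fun i => A i (pi i) == (-1)%R); split.
  move=> i j Epi; have /eqP/cards1P[l El] := A_col (pi i).
  have : i \in [set i' | A i' (pi i) != 0%R] by rewrite inE.
  have : j \in [set i' | A i' (pi i) != 0%R] by rewrite inE Epi.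
  by rewrite El !inE => /eqP -> /eqP ->.
move=> i x; rewrite mxE (bigD1 (pi i)) //= big1 ?addr0 => [|j nj].
  congr (_ * _)%R; have := A_val i (pi i).
  rewrite !inE => /or3P[/eqP -> //|A0|/eqP -> //].
  by have := piP i; rewrite A0.
by case: (eqVneq (A i j) 0%R) => [->|/pi_uniq E]; rewrite ?mul0r // E eqxx in nj *.
Qed.

Lemma sign_mul_lt (e : bool) (x y : int) :
  ((-1) ^+ e * x < (-1) ^+ e * y)%R = if e then (y < x)%R else (x < y)%R.
Proof. by case: e; rewrite ?expr1 ?expr0 ?mulN1r ?mul1r ?ltrN2. Qed.

(** The matrix may move or negate coordinate 0, by which points are listed; [g] records the
    resulting relabeling of positions. *)
Lemma sym_class_embedding d k (p q : dperm d.+1 k) : sym_class p q ->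
  exists (pi : 'I_d.+1 -> 'I_d.+1) (e : 'I_d.+1 -> bool) (g : 'I_k -> 'I_k),
  [/\ injective pi, injective g & forall i a b,
  (bar q i a < bar q i b) =
  flip_lt (e i) (bar p (pi i) (g a)) (bar p (pi i) (g b))].
Proof.
case=> A /signed_perm_mxP[pi [e [pi_inj AE]]].
case/standardizes_to_diagram => g [gP g_ord].
have ex a : exists c, g a == (A *m dpoint p c)%R.
  by have /imfsetP[_ /diagramP[c ->] ->] := gP a; exists c.
have [h gh] : exists h : 'I_k -> 'I_k, forall a, g a = (A *m dpoint p (h a))%R.
  by exists (fun a => xchoose (ex a)) => a; apply/eqP/(xchooseP (ex a)).
have ord i a b : (bar q i a < bar q i b) =
    flip_lt (e i) (bar p (pi i) (h a)) (bar p (pi i) (h b)).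
  by rewrite -g_ord !gh !AE sign_mul_lt !dpoint_lt.
exists pi, e, h; split=> // a b hab; apply: val_inj.
have := ord ord0 a b; have := ord ord0 b a.
by rewrite hab /flip_lt ltnn if_same bar0 !perm1 /=; lia.
Qed.

(** A converse without relabeling, for symmetries that keep the order of the positions. *)
Lemma embedding_sym_class d k (p q : dperm d.+1 k) (pi : 'S_d.+1)
    (e : 'I_d.+1 -> bool) :
  (forall i a b, (bar q i a < bar q i b) =
     flip_lt (e i) (bar p (pi i) a) (bar p (pi i) b)) ->
  sym_class p q.
Proof.
move=> pq; pose A : 'M[int]_d.+1 :=
  (\matrix_(i, j) (if j == pi i then (-1) ^+ e i else 0))%R.
have A_nz i j : (A i j != 0%R) = (j == pi i).
  by rewrite mxE; case: (j == pi i); rewrite ?eqxx // signr_eq0.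
have AE i (x : 'cV[int]_d.+1) :
    (A *m x)%R i ord0 = ((-1) ^+ e i * x (pi i) ord0)%R.
  rewrite mxE (bigD1 (pi i)) //= mxE eqxx big1 ?addr0 // => j /negPf nj.
  by rewrite mxE nj mul0r.
exists A.
  split=> [i j|i|j]; first by rewrite mxE; case: ifP; case: (e i).
    apply/eqP/cards1P; exists (pi i); apply/setP=> j.
    by rewrite !inE A_nz.
  apply/eqP/cards1P; exists ((pi^-1)%g j); apply/setP=> i.
  by rewrite !inE A_nz eq_sym (canF_eq (permK pi)).
have -> : [fset (A *m x)%R | x in diagram p]%fset =
    [fset (A *m dpoint p a)%R | a in 'I_k]%fset.
  apply/fsetP=> x; apply/imfsetP/imfsetP => /= [[_ /diagramP[a ->] ->]|[a _ ->]].
    by exists a.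
  by exists (dpoint p a) => //; apply/diagramP; exists a.
apply: diagram_standardization => i a b.
by rewrite !AE sign_mul_lt !dpoint_lt pq.
Qed.

End Diagrams.

(** * Occurrences of Sym((132,213)) and color triangles *)

Lemma contains_sym_class d d' n k (s : dperm d n) (p : dperm d'.+1 k)
    (f : 'I_d'.+1 -> 'I_d) (h : 'I_k -> 'I_n) (pi : 'S_d'.+1) (e : 'I_d'.+1 -> bool) :
  increasing f -> pi ord0 = ord0 -> e ord0 = false ->
  (forall i a b, (bar s (f i) (h a) < bar s (f i) (h b)) =
     flip_lt (e i) (bar p (pi i) a) (bar p (pi i) b)) ->
  exists2 q, sym_class p q & dperm_contains s q.
Proof.
move=> f_inc pi0 e0 ord.
have h_inj : injective h.
  move=> a b hab; apply: val_inj.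
  have := ord ord0 a b; have := ord ord0 b a.
  by rewrite hab ltnn e0 pi0 /flip_lt bar0 !perm1 /=; lia.
have inj i : injective (fun a => val (bar s (f i) (h a))).
  by move=> a b /val_inj/perm_inj/h_inj.
(* The pattern formed by the positions [h] in the coordinates [f]. Since [pi] and [e] fix coordinate
   0, the positions [h] are increasing and coordinate 0 of [q] is rightly the identity. *)
pose q : dperm d'.+1 k := [tuple rank_perm (inj (lift ord0 i)) | i < d'].
have q_ord i a b :
    (bar s (f i) (h a) < bar s (f i) (h b)) = (bar q i a < bar q i b).
  case: (unliftP ord0 i) => [j|] ->; last by rewrite ord pi0 e0 !bar0.
  by rewrite bar_lift tnth_mktuple rank_perm_lt.
exists q; last exact: embedding_dperm_contains q_ord.
by apply: (@embedding_sym_class _ _ _ _ pi e) => i a b; rewrite -q_ord.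
Qed.

Lemma bar_p132_213 (i a : 'I_3) : bar p132_213 i a =
  nth 0 (nth [::] [:: [:: 0; 1; 2]; [:: 0; 2; 1]; [:: 1; 0; 2]] i) a :> nat.
Proof.
case: i => [[|[|[|//]]] ?]; rewrite /bar /= ?p132E ?p213E // perm1.
by case: a => [[|[|[|//]]]].
Qed.

(* The points of (132,213) have a different middle point in each of the three
   coordinates, a property invariant under all signed permutations of the axes. *)
Lemma no_three_middles_avoids d n (s : dperm d.+1 n) :
  no_three_middles s -> dperm_avoids s (sym_class p132_213).
Proof.
move=> Ms q /sym_class_embedding[pi [e [g [pi_inj g_inj pq]]]].
case/dperm_contains_embedding => f [h qs].
have [gi giK gK] := injF_bij g_inj; have [qi piiK piK] := injF_bij pi_inj.
have btw l a b c : between (bar p132_213 l) a b c ->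
    between (bar s (f (qi l))) (h (gi a)) (h (gi b)) (h (gi c)).
  rewrite /between !qs !pq !gK piK /flip_lt; case: (e _) => //.
  by lia.
(* In (132,213), position 0 is the middle point of coordinate 2, position 1 that of coordinate 0,
   and position 2 that of coordinate 1. *)
apply: (Ms (h \o gi) (f (qi (inord 2))) (f (qi ord0)) (f (qi (inord 1)))).
by split; apply: btw; rewrite /between !bar_p132_213 !inordK.
Qed.

Lemma tnth3E T (x y z : T) :
  ((tnth [tuple x; y; z] ord0 = x) * (tnth [tuple x; y; z] (inord 1) = y) *
   (tnth [tuple x; y; z] (inord 2) = z))%type.
Proof. by rewrite !(tnth_nth x) !inordK. Qed.

(** The inequality of booleans puts [t a] between the other two values, so the word is 213 or its
    complement 231. *)
Lemma first_middle n (t : 'S_n) (a b c : 'I_n) : a < b < c ->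
  (t a < t c) != (t a < t b) -> forall x y : 'I_3,
  (t (tnth [tuple a; b; c] x) < t (tnth [tuple a; b; c] y)) =
  flip_lt (t c < t a) (nth 0 [:: 1; 0; 2] x) (nth 0 [:: 1; 0; 2] y).
Proof.
move=> abc mid x y /=; rewrite !(tnth_nth a) /flip_lt.
have eab : (t b < t a) = ~~ (t a < t b) by apply: perm_gtN; lia.
have eac : (t c < t a) = ~~ (t a < t c) by apply: perm_gtN; lia.
by case: x y => [[|[|[|//]]] ?] [[|[|[|//]]] ?]; case: ifP => /= ca; lia.
Qed.

(** Here [t c] is the middle value, so the word is 132 or its complement 312. *)
Lemma last_middle n (t : 'S_n) (a b c : 'I_n) : a < b < c ->
  (t a < t c) != (t b < t c) -> forall x y : 'I_3,
  (t (tnth [tuple a; b; c] x) < t (tnth [tuple a; b; c] y)) =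
  flip_lt (t c < t a) (nth 0 [:: 0; 2; 1] x) (nth 0 [:: 0; 2; 1] y).
Proof.
move=> abc mid x y /=; rewrite !(tnth_nth a) /flip_lt.
have ebc : (t c < t b) = ~~ (t b < t c) by apply: perm_gtN; lia.
have eac : (t c < t a) = ~~ (t a < t c) by apply: perm_gtN; lia.
by case: x y => [[|[|[|//]]] ?] [[|[|[|//]]] ?]; case: ifP => /= ca; lia.
Qed.

(** Otherwise some coordinate [i] has [a] as middle point and some [j] has [c], while the identity
    coordinate has [b]. These three coordinates form a forbidden pattern. *)
Lemma avoids_color_triangle d n (s : dperm d.+1 n) :
  dperm_avoids s (sym_class p132_213) ->
  forall a b c : 'I_n, a < b < c ->
  color s a c = color s a b \/ color s a c = color s b c.
Proof.
move=> avoid a b c abc.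
case: (eqVneq (color s a c) (color s a b)) => [|ab]; first by left.
case: (eqVneq (color s a c) (color s b c)) => [|bc]; first by right.
have diff (u v : {ffun 'I_d -> bool}) : u != v -> exists i, u i != v i.
  move=> uv; apply/existsP; apply: contraNT uv => /existsPn E.
  by apply/eqP/ffunP=> i; apply/eqP; have := E i; rewrite negbK.
have [i] := diff _ _ ab; have [j] := diff _ _ bc; rewrite !ffunE => jbc iab.
pose h := tnth [tuple a; b; c].
have h_lt x y : (h x < h y) = (x < y).
  by case: x y => [[|[|[|//]]] ?] [[|[|[|//]]] ?]; rewrite /h !(tnth_nth a) /=; lia.
pose f k l := tnth [tuple ord0; lift ord0 k; lift ord0 l] : 'I_3 -> 'I_d.+1.
have f_inc (k l : 'I_d) : k < l -> increasing (f k l).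
  by move=> kl [[|[|[|//]]] ?] [[|[|[|//]]] ?] //; rewrite /f !(tnth_nth ord0).
have {}iab := first_middle abc iab; have {}jbc := last_middle abc jbc.
exfalso; case: (ltngtP i j) => ij.
(* The coordinates come in the order identity, 213, 132 up to complement, so the last two must be
   exchanged to match (132,213). *)
- have tp0 : tperm (inord 1) (inord 2) ord0 = ord0 :> 'I_3.
    by rewrite tpermD // -val_eqE /= inordK.
  have [||||q] := @contains_sym_class _ _ _ _ s p132_213 (f i j) h
    (tperm (inord 1) (inord 2))
    (tnth [tuple false; tnth s i c < tnth s i a; tnth s j c < tnth s j a]);
    [exact: f_inc | exact: tp0 | by rewrite tnth3E | | by move/avoid].
  apply: ord3P => x y; rewrite ?tpermL ?tpermR ?tp0 tnth3E /f tnth3E !bar_p132_213;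
    rewrite ?inordK //= ?bar_lift ?bar0 ?perm1 ?h_lt //.
  by case: x y => [[|[|[|//]]] ?] [[|[|[|//]]] ?].
- have [||||q] := @contains_sym_class _ _ _ _ s p132_213 (f j i) h 1%g
    (tnth [tuple false; tnth s j c < tnth s j a; tnth s i c < tnth s i a]);
    [exact: f_inc | by rewrite perm1 | by rewrite tnth3E | | by move/avoid].
  apply: ord3P => x y; rewrite perm1 tnth3E /f tnth3E !bar_p132_213;
    rewrite ?inordK //= ?bar_lift ?bar0 ?perm1 ?h_lt //.
  by case: x y => [[|[|[|//]]] ?] [[|[|[|//]]] ?].
(* A single coordinate cannot have both [a] and [c] as middle point. *)
- have {ij}ij := val_inj ij; subst j.
  have := iab (inord 1) (inord 2); rewrite jbc !inordK // /flip_lt.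
  by case: ifP.
Qed.

Theorem theorem2 (d n : nat) (hd : (2 <= d)%N) (hn : (1 <= n)%N)
    (s : dperm d n) :
  separable_dperm s <->
  (forall i : 'I_d.-1,
     perm_avoids (tnth s i) p2413 /\ perm_avoids (tnth s i) p3142) /\
  dperm_avoids s (sym_class p132_213).
Proof.
case: d hd s => // d _ s; split=> [/separable_avoids[Ms As]|[As Ss]].
  by split=> //; apply: no_three_middles_avoids.
by apply: color_good_separable => //; split=> //; apply: avoids_color_triangle.
Qed.
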